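(* Let $S$ be a numerical monoid with $\mathcal A (S) = \{ n_1,n_2,n_3 \}$ (three distinct atoms), where $\gcd (n_1, n_2) = \gcd (n_1, n_3) = \gcd (n_2, n_3) = 1$. Then $S$ has a generic presentation and $\mathsf c (S) = \omega (S) = \mathsf t (S)$. More precisely, if for $\{i,j,k\}=\{1,2,3\}$ \[ c_i=\min\{ m\in \mathbb N \mid m n_i\in \langle n_j,n_k\rangle\} \quad \text{and} \quad c_in_i=r_{i,j}n_j+r_{i,k}n_k \] with $r_{i,j}, r_{i,k} \in \mathbb N_0$, then \[ \mathsf c(S)=\max\{c_1,\,c_2,\,c_3,\,r_{1,2}+r_{1,3},\,r_{2,1}+r_{2,3},\,r_{3,1}+r_{3,2}\}. \]
   Context: $\mathbb N$ denotes the positive integers, $\mathbb N_0=\mathbb N\cup\{0\}$. A numerical monoid is a submonoid $S\subset(\mathbb N_0,+)$ with $\mathbb N\setminus S$ finite; $\mathcal A(S)$ is its set of atoms (its minimal generating set), and $\langle a,b\rangle=\{xa+yb\mid x,y\in\mathbb N_0\}$. $\mathsf Z(S)$ is the free abelian monoid with basis $\mathcal A(S)$ (elements are formal sums of atoms), $|z|$ the length and $\mathrm{supp}(z)$ the set of atoms occurring in $z\in\mathsf Z(S)$; $\pi\colon\mathsf Z(S)\to S$ is the homomorphism which is the identity on atoms; $\mathsf Z(a)=\pi^{-1}(a)$ for $a \in S$; $\sim_S\,=\{(x,y)\in\mathsf Z(S)\times\mathsf Z(S)\mid\pi(x)=\pi(y)\}$. In $S$, $a$ divides $b$ means $b-a\in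 S$. A subset $\sigma\subset\,\sim_S$ is a presentation of $S$ if the congruence on $\mathsf Z(S)$ generated by $\sigma$ equals $\sim_S$; it is minimal if no proper subset generates $\sim_S$; it is generic if it is a minimal presentation and for all $(x,y)\in\sigma$ we have $\mathrm{supp}(x)\cup\mathrm{supp}(y)=\mathcal A(S)$. The distance of $z,z'\in\mathsf Z(S)$ is $\mathsf d(z,z')=\max\{|z-\gcd(z,z')|,|z'-\gcd(z,z')|\}$. Catenary degree: $\mathsf c(a)$ is the smallest $N\in\mathbb N_0\cup\{\infty\}$ such that for any $z,z'\in\mathsf Z(a)$ there are $z=z_0,\dots,z_l=z'$ in $\mathsf Z(a)$ with $\mathsf d(z_{i-1},z_i)\le N$ for all $i$; $\mathsf c(S)=\sup_{a\in S}\mathsf c(a)$. $\omega$-invariant: $\omega(S,b)$ is the smallest $N\in\mathbb N_0\cup\{\infty\}$ such that whenever $b$ divides $a_1+\dots+a_n$ in $S$ with $n\in\mathbb N$, $a_i\in S$, there is $\Omega\subset[1,n]$ with $|\Omega|\le N$ such that $b$ divides $\sum_{\nu\in\Omega}a_\nu$ in $S$; $\omega(S)=\sup\{\omega(S,u)\mid u\in\mathcal A(S)\}$. Tame degree: for $a\in S$, $u\in\mathcal A(S)$, $\mathsf t(a,u)$ is the smallest $N\in\mathbb N_0\cup\{\infty\}$ such that: if some factorization in $\mathsf Z(a)$ contains $u$ and $z\in\mathsf Z(a)$, then there is $z'\in\mathsf Z(a)$ containing $u$ with $\mathsf d(z,z')\le N$; $\mathsf t(S)=\sup\{\mathsf t(a,u)\mid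 a\in S,\,u\in\mathcal A(S)\}$. *)

(* Defs.v *)
From mathcomp Require Import all_boot.
From mathcomp Require Import finmap multiset.
From mathcomp Require Import all_classical.

Set Implicit Arguments.
Unset Strict Implicit.
Unset Printing Implicit Defensive.

Local Open Scope classical_set_scope.
Local Open Scope nat_scope.

(* N_0 with infinity: [None] stands for infinity. *)
Definition enat := option nat.

Definition enat_le (x : enat) (m : nat) : bool :=
  if x is Some k then k <= m else false.

(* Smallest element of A in N_0 with infinity; it is infinity if A is empty. *)
Definition emin (A : set nat) : enat :=
  if pselect (exists m, `[< A m >]) is left exA then Some (ex_minn exA)
  else None.

Definition esup (A : set enat) : enat :=
  emin [set N | forall x, A x -> enat_le x N].

Definition numerical_monoid (S : set nat) : Prop :=
  [/\ S 0,
      forall a b, S a -> S b -> S (a + b)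
    & finite_set ([set m | 0 < m] `\` S)].

Definition atoms (S : set nat) : set nat :=
  [set a | [/\ S a, a <> 0
    & forall b c, S b -> S c -> a = b + c -> b = 0 \/ c = 0]].

Definition divides (S : set nat) (a b : nat) : Prop := a <= b /\ S (b - a).

Definition gen2 (a b : nat) : set nat :=
  [set m | exists x y, m = x * a + y * b].

(* Elements of the free abelian monoid over the atoms are the finite multisets
   of natural numbers all of whose members are atoms; the monoid operation is
   the multiset sum, the gcd is the multiset intersection and the length is
   [size]. *)
Definition fact_monoid (S : set nat) : set {mset nat}%mset :=
  [set z | [set` z] `<=` atoms S].

Definition fact_eval (z : {mset nat}%mset) : nat := \sum_(a <- z) a.

Definition factorizations (S : set nat) (a : nat) : set {mset nat}%mset :=
  [set z | fact_monoid S z /\ fact_eval z = a].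

Definition fact_dist (z z' : {mset nat}%mset) : nat :=
  maxn (size (z `\` (z `&` z'))%mset) (size (z' `\` (z `&` z'))%mset).

Definition fact_rel (S : set nat) : set ({mset nat}%mset * {mset nat}%mset) :=
  [set p | [/\ fact_monoid S p.1, fact_monoid S p.2
             & fact_eval p.1 = fact_eval p.2]].

Definition is_congruence (S : set nat)
    (R : set ({mset nat}%mset * {mset nat}%mset)) : Prop :=
  [/\ R `<=` fact_monoid S `*` fact_monoid S,
      forall x, fact_monoid S x -> R (x, x),
      forall x y, R (x, y) -> R (y, x),
      forall x y z, R (x, y) -> R (y, z) -> R (x, z)
    & forall x y z, R (x, y) -> fact_monoid S z ->
        R ((x `+` z)%mset, (y `+` z)%mset)].

Definition presentation (S : set nat)
    (sigma : set ({mset nat}%mset * {mset nat}%mset)) : Prop :=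
  sigma `<=` fact_rel S /\ smallest (is_congruence S) sigma = fact_rel S.

Definition minimal_presentation (S : set nat)
    (sigma : set ({mset nat}%mset * {mset nat}%mset)) : Prop :=
  presentation S sigma /\
  forall tau, tau `<` sigma -> smallest (is_congruence S) tau <> fact_rel S.

Definition generic_presentation (S : set nat)
    (sigma : set ({mset nat}%mset * {mset nat}%mset)) : Prop :=
  minimal_presentation S sigma /\
  forall x y, sigma (x, y) -> [set` x] `|` [set` y] = atoms S.

Definition catenary_degree_at (S : set nat) (a : nat) : enat :=
  emin [set N | forall z z',
    factorizations S a z -> factorizations S a z' ->
    exists s : seq {mset nat}%mset,
      [/\ forall w, w \in s -> factorizations S a w,
          path (fun x y => fact_dist x y <= N) z s
        & last z s = z']].

Definition catenary_degree (S : set nat) : enat :=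
  esup [set catenary_degree_at S a | a in S].

Definition omega_at (S : set nat) (b : nat) : enat :=
  emin [set N | forall (n : nat) (a : 'I_n -> nat),
    0 < n -> (forall i, S (a i)) -> divides S b (\sum_(i < n) a i) ->
    exists Omega : {set 'I_n},
      #|Omega| <= N /\ divides S b (\sum_(i in Omega) a i)].

Definition omega (S : set nat) : enat :=
  esup [set omega_at S u | u in atoms S].

Definition tame_degree_at (S : set nat) (a u : nat) : enat :=
  emin [set N |
    (exists2 w, factorizations S a w & u \in w) ->
    forall z, factorizations S a z ->
    exists z', [/\ factorizations S a z', u \in z' & fact_dist z z' <= N]].

Definition tame_degree (S : set nat) : enat :=
  esup [set tame_degree_at S a u | a in S & u in atoms S].

(* Main.v *)
Require Import Defs.
From mathcomp Require Import all_boot.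
From mathcomp Require Import finmap multiset.
From mathcomp Require Import all_classical.
From mathcomp Require Import zify.

(* Any relation c_i n_i = r_ij n_j + r_ik n_k with c_i minimal has r_ij, r_ik > 0:
   pairwise coprimality makes n_j congruent to m n_i modulo n_k for some
   0 < m < n_k, so c_i < n_k, whereas r_ij = 0 would force n_k to divide c_i.
   Consequently c_i n_i has exactly two factorizations, c_i e_i and
   r_ij e_j + r_ik e_k, and whenever a factorization z avoids an atom that
   occurs in some other factorization of the same element, z contains a side of
   one of the three relations whose opposite side contains that atom.  This
   exchange property alone makes the three relations a generic presentation and
   bounds the catenary, omega and tame degrees by the largest length N of a side
   of a relation; N is attained by all three at the elements c_i n_i, because
   these have only two factorizations, with no common atom. *)

Local Open Scope classical_set_scope.
Local Open Scope nat_scope.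

(** * Minima and suprema in N_0 with infinity *)

Lemma emin_Some (A : set nat) k :
  A k -> (forall m, A m -> k <= m) -> emin A = Some k.
Proof.
move=> Ak kmin; rewrite /emin; case: pselect => [exA|[]]; last first.
  by exists k; apply/asboolP.
case: ex_minnP => m /asboolP Am mmin; congr Some.
by apply/eqP; rewrite eqn_leq kmin// mmin//; apply/asboolP.
Qed.

Lemma emin_SomeE (A : set nat) k :
  emin A = Some k -> A k /\ forall m, A m -> k <= m.
Proof.
rewrite /emin; case: pselect => // exA [<-]; case: ex_minnP => m /asboolP Am mmin.
by split=> // j Aj; apply: mmin; apply/asboolP.
Qed.

Lemma emin_inhabited (A : set nat) m : A m -> exists k, emin A = Some k.
Proof.
move=> Am; rewrite /emin; case: pselect => [exA|[]]; last first.
  by exists m; apply/asboolP.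
by exists (ex_minn exA).
Qed.

Lemma enat_le_emin (A : set nat) m : A m -> enat_le (emin A) m.
Proof.
by move=> Am; have [k Ek] := emin_inhabited _ _ Am; rewrite Ek; have [_] :=
  emin_SomeE _ _ Ek; apply.
Qed.

(** Only some [k <= m] is produced, as [A] need not be upward closed; this suffices for lower bounds
    on the degrees. *)
Lemma enat_le_eminE (A : set nat) m :
  enat_le (emin A) m -> exists2 k, k <= m & A k.
Proof.
case E: (emin A) => [k|] //= km; exists k => //.
by have [] := emin_SomeE _ _ E.
Qed.

Lemma esup_Some (A : set enat) N :
  (forall x, A x -> enat_le x N) ->
  (forall M, (forall x, A x -> enat_le x M) -> N <= M) -> esup A = Some N.
Proof. exact: emin_Some. Qed.

(** * Multisets: length, value, distance and sums *)

Section Multisets.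
Implicit Types x y z p q r : {mset nat}%mset.

Lemma perm_msetD x y : perm_eq (x `+` y)%mset (x ++ y).
Proof. by apply/allP => a _ /=; rewrite count_cat !count_mem_mset msetE2. Qed.

Lemma size_msetD x y : size (x `+` y)%mset = size x + size y.
Proof. by rewrite (perm_size (perm_msetD x y)) size_cat. Qed.

Lemma size_msetS x y : (x `<=` y)%mset -> size x <= size y.
Proof. by move=> /msetBDKC <-; rewrite size_msetD leq_addr. Qed.

Lemma mset_neq0_ex x : x != mset0 -> exists u, u \in x.
Proof.
move=> x0; apply: contrapT => nex; move/eqP: x0; apply.
apply/msetP => a; rewrite mset0E; apply/eqP; rewrite mset_eq0.
by apply/negP => ax; apply: nex; exists a.
Qed.

Lemma mset_eq0_size x : size x = 0 -> x = mset0.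
Proof.
move=> /size0nil x0; apply/msetP => a.
by rewrite mset0E -count_mem_mset x0.
Qed.

Lemma fact_eval0 : fact_eval mset0 = 0.
Proof. by rewrite /fact_eval big_mset0. Qed.

Lemma fact_eval1 u : fact_eval [mset u]%mset = u.
Proof. by rewrite /fact_eval big_msetn. Qed.

Lemma fact_evalD x y : fact_eval (x `+` y)%mset = fact_eval x + fact_eval y.
Proof. by rewrite /fact_eval (perm_big _ (perm_msetD x y)) big_cat. Qed.

Lemma fact_distC x y : fact_dist x y = fact_dist y x.
Proof. by rewrite /fact_dist maxnC msetIC. Qed.

Lemma fact_distD p q r : fact_dist (p `+` r)%mset (q `+` r)%mset = fact_dist p q.
Proof. by rewrite /fact_dist -msetDIl !msetBDr. Qed.

Lemma fact_dist_le p q : fact_dist p q <= maxn (size p) (size q).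
Proof.
rewrite /fact_dist geq_max !leq_max; apply/andP; split; apply/orP; [left|right];
  exact: size_msetS (msubsetDl _ _).
Qed.

Lemma fact_dist_disjoint p q :
  (p `&` q)%mset = mset0 -> fact_dist p q = maxn (size p) (size q).
Proof. by move=> pq; rewrite /fact_dist pq !msetB0. Qed.

Lemma fact_distxx x : fact_dist x x = 0.
Proof. by rewrite /fact_dist msetIid msetBxx enum_mset0. Qed.

Lemma mset_sumE (I : finType) (P : pred I) (z : I -> {mset nat}%mset) a :
  (\big[msetD/mset0]_(i | P i) z i)%mset a = \sum_(i | P i) z i a.
Proof.
apply: (big_morph (fun x : {mset nat}%mset => x a)) => [x y|]; last exact: mset0E.
by rewrite msetE2.
Qed.

Lemma mset_sum_nth p : p = (\big[msetD/mset0]_(i < size p) [mset (nth 0 p i)])%mset.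
Proof.
rewrite -[LHS]seq_mset_id; move: (enum_mset p) => s.
elim: s => [|u s IHs]; last by rewrite big_ord_recl mset_cons IHs.
by rewrite big_ord0; apply/msetP => a; rewrite mset_seqE mset0E.
Qed.

(* One index is spent per element of [p]. *)
Lemma msubset_sum_bound n (z : 'I_n -> {mset nat}%mset) p :
  (p `<=` \big[msetD/mset0]_i z i)%mset ->
  exists Omega : {set 'I_n}, #|Omega| <= size p /\
    (p `<=` \big[msetD/mset0]_(i in Omega) z i)%mset.
Proof.
move E: (size p) => k; elim: k p E => [|k IHk] p pk pz.
  exists finset.set0; rewrite cards0 (mset_eq0_size _ pk); split=> //.
  exact: msub0set.
have [u up] : exists u, u \in p.
  by apply: mset_neq0_ex; apply: contra_eq_neq pk => ->; rewrite enum_mset0.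
have pE : p = (u +` (p `\ u))%mset by rewrite msetB1K.
have pk' : size (p `\ u)%mset = k.
  by have := size_msetD [mset u]%mset (p `\ u)%mset; rewrite -pE pk enum_msetn /=;
    lia.
have [|Om [Omk pOm]] := IHk _ pk'.
  by apply: msubset_trans pz; apply: msubD1set.
(* Either the indices found for [p] without one [u] already supply all copies of [u], or some index
   outside [Om] must contribute one, because the full sum contains [p]. *)
have [pu|pu] := leqP (p u) (\sum_(i in Om) z i u).
  exists Om; split; first exact: leqW.
  apply/msubsetP => a; rewrite mset_sumE.
  have := msubsetP pOm a; rewrite mset_sumE msetB1E.
  by case: eqP => [->//|_]; rewrite subn0.
have [i iOm zi] : exists2 i, i \notin Om & u \in z i.
  apply: contrapT => nex; have := msubsetP pz u; rewrite mset_sumE leqNgt => /negP;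
    apply.
  rewrite (bigID (mem Om)) /= [X in _ + X]big1 ?addn0// => i iOm.
  apply/eqP; rewrite mset_eq0; apply/negP => zi; apply: nex; by exists i.
exists (i |: Om)%SET; rewrite cardsU1 iOm add1n; split=> //.
apply/msubsetP => a; rewrite mset_sumE big_setU1//= pE mset1DE.
apply: leq_add; last by rewrite -mset_sumE; apply: (msubsetP pOm).
by case: eqP => [->|//]; rewrite mset_gt0.
Qed.

End Multisets.

(** * Factorizations in a numerical monoid *)

Section Factorizations.
Variable S : set nat.
Hypothesis hS : numerical_monoid S.
Implicit Types x y z p q r : {mset nat}%mset.

Lemma fact_monoid0 : fact_monoid S mset0.
Proof. by move=> u /=; rewrite in_mset0. Qed.

Lemma fact_monoid1 u : atoms S u -> fact_monoid S [mset u]%mset.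
Proof. by move=> Su v /=; rewrite in_mset1 => /eqP ->. Qed.

Lemma fact_monoidD x y :
  fact_monoid S x -> fact_monoid S y -> fact_monoid S (x `+` y)%mset.
Proof. by move=> Sx Sy u /=; rewrite in_msetD => /orP[/Sx|/Sy]. Qed.

Lemma fact_monoidS x y :
  (x `<=` y)%mset -> fact_monoid S y -> fact_monoid S x.
Proof. by move=> /msubset_subset xy Sy u /= /xy /Sy. Qed.

Lemma fact_eval_monoid x : fact_monoid S x -> S (fact_eval x).
Proof.
case: hS => S0 SD _ Sx; rewrite /fact_eval big_seq.
by elim/big_ind: _ => // u /Sx [].
Qed.

Lemma fact_eval_eq0 x : fact_monoid S x -> fact_eval x = 0 -> x = mset0.
Proof.
move=> Sx x0; apply/eqP; apply: contrapT => /negP /mset_neq0_ex[u ux].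
have [_ + _] := Sx _ ux; apply.
by have := fact_evalD [mset u]%mset (x `\ u)%mset; rewrite msetB1K// x0 fact_eval1;
  lia.
Qed.

(** Strong induction: a nonzero element that is no atom splits into two strictly smaller elements of
    [S]. *)
Lemma factorization_exists s : S s -> exists z, factorizations S s z.
Proof.
elim/ltn_ind: s => s IHs Ss.
have [->|s0] := eqVneq s 0.
  by exists mset0; split; [exact: fact_monoid0|exact: fact_eval0].
have [sA|sA] := pselect (atoms S s).
  by exists [mset s]%mset; split; [exact: fact_monoid1|exact: fact_eval1].
have [b [c [Sb Sc sbc b0 c0]]] :
    exists b c, [/\ S b, S c, s = b + c, b <> 0 & c <> 0].
  apply: contrapT => nex; apply: sA; split=> //; first exact/eqP.
  move=> b c Sb Sc sbc; apply: contrapT => /not_orP[b0 c0].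
  by apply: nex; exists b, c.
have [|x [Sx xb]] := IHs b _ Sb; first lia.
have [|y [Sy yc]] := IHs c _ Sc; first lia.
exists (x `+` y)%mset; split; first exact: fact_monoidD.
by rewrite fact_evalD xb yc.
Qed.

Lemma fact_rel_congruence : is_congruence S (fact_rel S).
Proof.
split=> [[x y] []//|x Sx|x y []|x y z [/= Sx Sy xy] [/= _ Sz yz]|x y z [/= Sx Sy xy]
  Sz].
- by split.
- by split.
- by split=> //=; rewrite xy.
- by split; rewrite /= ?fact_evalD ?xy//; apply: fact_monoidD.
Qed.

(** The value of [p] then has exactly two factorizations, and they share no atom: a Betti element of
    the simplest kind. *)
Definition isolated_pair p q :=
  [/\ fact_rel S (p, q), p != mset0, q != mset0, (p `&` q)%mset = mset0
    & forall z, factorizations S (fact_eval p) z -> z = p \/ z = q].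

Lemma isolated_pairC p q : isolated_pair p q -> isolated_pair q p.
Proof.
move=> [[/= Sp Sq pq] p0 q0 pIq pE]; split=> //; first by rewrite msetIC.
by move=> z; rewrite -pq => /pE[]; [right|left].
Qed.

(** A single application of a relation, in either direction, brings a missing atom [u] into [z] as
    soon as some factorization of the same element contains [u]. *)
Definition exchange (sigma : set ({mset nat}%mset * {mset nat}%mset)) :=
  forall u z w, fact_rel S (z, w) -> u \in w -> u \notin z ->
  exists p q, [/\ sigma (p, q) \/ sigma (q, p), (p `<=` z)%mset & u \in q].

(** * Minimal presentations and degrees from the exchange property *)

Section GenericRelations.
Variable sigma : set ({mset nat}%mset * {mset nat}%mset).
Hypothesis sigma_isolated : forall p q, sigma (p, q) -> isolated_pair p q.
Hypothesis sigma_asym : forall p q, sigma (p, q) -> ~ sigma (q, p).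
Hypothesis sigma_exchange : exchange sigma.

Let sym p q := sigma (p, q) \/ sigma (q, p).

Let sym_isolated p q : sym p q -> isolated_pair p q.
Proof. by case=> /sigma_isolated // /isolated_pairC. Qed.

Lemma exchange_step u z w : fact_rel S (z, w) -> u \in w -> u \notin z ->
  exists p q r, [/\ sym p q, z = (p `+` r)%mset, fact_monoid S r & u \in q].
Proof.
move=> zw uw uz; have [p [q [pq pz uq]]] := sigma_exchange _ _ _ zw uw uz.
exists p, q, (z `\` p)%mset; split=> //; first by rewrite msetBDKC.
by apply: fact_monoidS (msubsetDl _ _) _; case: zw.
Qed.

(** Induction on the length of [y]: at most one exchange turns [x] into some [x'] containing a
    chosen atom [u] of [y]; then [u] is removed from [x'] and [y], which leaves a shorter [y]. *)
Lemma congruence_fact_rel R :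
  is_congruence S R -> sigma `<=` R -> fact_rel S `<=` R.
Proof.
move=> [RS Rxx Rsym Rtr RD] sR [x y].
move: {2}(size y).+1 (ltnSn (size y)) => n.
elim: n x y => // n IHn x y yn xy; have [/= Sx Sy exy] := xy.
have [y0|/mset_neq0_ex[u uy]] := eqVneq y mset0.
  have -> : x = mset0 by apply: fact_eval_eq0; rewrite // exy y0 fact_eval0.
  by rewrite y0; apply: Rxx; exact: fact_monoid0.
have [x' [Rxx' ux' xx']] : exists x', [/\ R (x, x'), u \in x' & fact_rel S (x, x')].
  have [ux|ux] := boolP (u \in x); first by exists x; split=> //; exact: Rxx.
  have [p [q [r [pq xE Sr uq]]]] := exchange_step _ _ _ xy uy ux.
  have [[/= Sp Sq epq] _ _ _ _] := sym_isolated _ _ pq.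
  exists (q `+` r)%mset; rewrite in_msetD uq; split=> //.
    by rewrite xE; apply: RD => //; case: pq => /sR // /Rsym.
  by split; rewrite //= ?xE ?fact_evalD ?epq//; exact: fact_monoidD.
have [/= _ Sx' exx'] := xx'.
apply: (Rtr _ _ _ Rxx'); rewrite -(msetB1K ux') -(msetB1K uy).
rewrite ![(u +` _)%mset]msetDC.
apply: RD; last exact: fact_monoid1 (Sy _ uy).
have := fact_evalD [mset u]%mset (x' `\ u)%mset.
have := fact_evalD [mset u]%mset (y `\ u)%mset.
have := size_msetD [mset u]%mset (y `\ u)%mset.
rewrite !msetB1K// enum_msetn !fact_eval1 /= => sy ey ex'.
apply: IHn; first by move: yn; rewrite sy add1n ltnS.
split=> /=; [exact: fact_monoidS (msubD1set _ _) Sx'|exact: fact_monoidS (msubD1set _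
  _) Sy|].
lia.
Qed.

Lemma sigma_fact_rel : sigma `<=` fact_rel S.
Proof. by case=> p q /sigma_isolated[]. Qed.

Lemma exchange_presentation : presentation S sigma.
Proof.
split; first exact: sigma_fact_rel.
apply/seteqP; split.
  exact: smallest_sub fact_rel_congruence sigma_fact_rel.
by move=> xy xyS R [RS sR]; exact: congruence_fact_rel RS sR _ xyS.
Qed.

(** Both [p + z] and [q + z] factor the value of [p'], and they differ, so they are [p'] and [q'] in
    some order. Hence [z] lies in both of these disjoint multisets and is empty. Distinct relations
    thus live at elements incomparable under divisibility. *)
Lemma isolated_pair_sub p q p' q' z :
  isolated_pair p q -> isolated_pair p' q' -> fact_monoid S z ->
  fact_eval p + fact_eval z = fact_eval p' ->
  (p = p' /\ q = q') \/ (p = q' /\ q = p').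
Proof.
move=> [[/= Sp Sq epq] p0 q0 pIq _] [_ p'0 q'0 p'Iq' p'E] Sz ez.
have eqz : fact_eval q + fact_eval z = fact_eval p' by rewrite -epq.
have pzE : (p `+` z)%mset = p' \/ (p `+` z)%mset = q'.
  by apply: p'E; split; [exact: fact_monoidD|rewrite fact_evalD].
have qzE : (q `+` z)%mset = p' \/ (q `+` z)%mset = q'.
  by apply: p'E; split; [exact: fact_monoidD|rewrite fact_evalD].
have pNq : (p `+` z)%mset <> (q `+` z)%mset.
  move=> /(congr1 (fun x => x `\` z)%mset); rewrite !msetDKBC => pq.
  by move: p0; rewrite -(msetIid p) {2}pq pIq eqxx.
have z0 : z = mset0.
  have : (z `<=` p' `&` q')%mset.
    apply/msubsetP => a.
    case: pzE qzE pNq => [e1|e1] [e2|e2]; rewrite ?e1 ?e2// -e1 -e2 => _;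
      by rewrite !msetE2 leq_min !leq_addl.
  by rewrite p'Iq' msubset0 => /eqP.
move: pzE qzE pNq; rewrite z0 !msetD0.
by case=> ->; case=> -> // _; [left|right].
Qed.

Lemma exchange_minimal : minimal_presentation S sigma.
Proof.
split; first exact: exchange_presentation.
move=> tau [ts nst] tauE; apply: nst => -[p q] pq; apply: contrapT => ntau.
have pqi := sigma_isolated _ _ pq; have [[/= Sp Sq epq] p0 q0 pIq _] := pqi.
(* [R] is trivial on the divisors of the value of [p] and full elsewhere. It is a congruence because
   divisors of divisors are divisors; it contains every relation other than [(p, q)] by
   incomparability, but not [(p, q)] itself. *)
pose R := [set xy | fact_rel S xy /\ (xy.1 = xy.2 \/ ~ divides S (fact_eval xy.1)
  (fact_eval p))].
have RS : is_congruence S R.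
  have [RS Rxx Rsym Rtr RD] := fact_rel_congruence.
  split.
  - by move=> xy [/RS].
  - by move=> x Sx; split; [exact: Rxx|left].
  - move=> x y [/= xy xyE]; split; first exact: Rsym.
    have [_ _ /= <-] := xy.
    by case: xyE => [->|]; [left|right].
  - move=> x y z [/= xy xyE] [/= yz yzE]; split; first exact: Rtr xy yz.
    have [_ _ /= exy] := xy.
    by case: xyE yzE => [->|nd _] //; right.
  - move=> x y z [/= xy xyE] Sz; split; first exact: RD.
    case: xyE => [->|nd]; [by left|right => /= -[le Sd]; apply: nd; split].
      by rewrite fact_evalD in le; lia.
    rewrite fact_evalD in le Sd.
    have [_ SD _] := hS; have := SD _ _ Sd (fact_eval_monoid _ Sz).
    by congr S; lia.
have tauR : tau `<=` R.
  move=> [p' q'] tpq'; have /= spq' := ts _ tpq'; have pqi' :=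
    sigma_isolated _ _ spq'.
  split; first by case: pqi'.
  right => -[/= le Sd]; have [z [Sz ez]] := factorization_exists _ Sd.
  have := isolated_pair_sub _ _ _ _ _ pqi' pqi Sz.
  rewrite ez subnKC// => /(_ erefl)[] [? ?]; subst p' q'; first exact: ntau.
  exact: sigma_asym pq spq'.
have : R (p, q).
  have : fact_rel S (p, q) by [].
  by rewrite -tauE; apply: smallest_sub.
case=> _ [/= pE|]; last by apply; split; rewrite ?subnn; case: hS.
by move: p0; rewrite -(msetIid p) {2}pE pIq eqxx.
Qed.

(** Distance is symmetric and unchanged by adding a common multiset, so chains can be reversed,
    concatenated and translated. A bound on the catenary degree therefore needs checking only on
    generators of the congruence. *)
Lemma chain_congruence N : is_congruence S
  [set zz' | fact_rel S zz' /\ exists s : seq {mset nat}%mset,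
    [/\ forall w, w \in s -> factorizations S (fact_eval zz'.1) w,
        path (fun x y => fact_dist x y <= N) zz'.1 s & last zz'.1 s = zz'.2]].
Proof.
have [RS Rxx Rsym Rtr RD] := fact_rel_congruence.
split.
- by move=> xy [/RS].
- by move=> x Sx; split; [exact: Rxx|exists [::]].
- move=> x y [/= xy [s [sS sp sl]]]; split; first exact: Rsym.
  have [/= Sx Sy exy] := xy.
  exists (rev (belast x s)); rewrite -exy; split=> /=.
  + move=> w; rewrite mem_rev => /mem_belast; rewrite in_cons => /predU1P[->|/sS //].
    by split.
  + rewrite -sl rev_path; apply: sub_path sp => a b; by rewrite fact_distC.
  + case: s {sS sp} sl => [/= ->//|a s _]; by rewrite /= rev_cons last_rcons.
- move=> x y z [/= xy [s [sS sp sl]]] [/= yz [t [tS tp tl]]].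
  split; first exact: Rtr xy yz.
  have [/= Sx Sy exy] := xy.
  exists (s ++ t); rewrite cat_path last_cat sl sp; split=> // w.
  by rewrite mem_cat exy => /orP[/sS|/tS//]; rewrite exy.
- move=> x y z [/= xy [s [sS sp sl]]] Sz; split; first exact: RD.
  exists [seq (w `+` z)%mset | w <- s]; split=> /=.
  + move=> _ /mapP[w /sS[Sw ew] ->]; split; first exact: fact_monoidD.
    by rewrite !fact_evalD ew.
  + by apply: (homo_path (f := fun w => w `+` z)%mset) sp => a b; rewrite fact_distD.
  + by rewrite (last_map (fun w => (w `+` z)%mset)) sl.
Qed.

Variable N : nat.
Hypothesis sigma0 : sigma !=set0.
Hypothesis sigma_le : forall p q, sigma (p, q) -> maxn (size p) (size q) <= N.
(** [N] enters as a least upper bound of the side lengths, so that a lower bound for a degree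
    reduces to one estimate per relation. *)
Hypothesis sigma_sup : forall M,
  (forall p q, sigma (p, q) -> maxn (size p) (size q) <= M) -> N <= M.

Let sym_le p q : sym p q -> maxn (size p) (size q) <= N.
Proof. by case=> /sigma_le //; rewrite maxnC. Qed.

Let N_gt0 : 0 < N.
Proof.
have [[p q] pq] := sigma0; have [_ p0 _ _ _] := sigma_isolated _ _ pq.
apply: leq_trans (sigma_le _ _ pq); rewrite leq_max lt0n; apply/orP; left.
by apply: contraNneq p0 => /mset_eq0_size ->.
Qed.

(** Each relation is itself a chain with one step of size at most [N]. Conversely, a chain from [p]
    to [q] can visit only [p] and [q], so it contains the direct jump between them. *)
Lemma exchange_catenary : catenary_degree S = Some N.
Proof.
apply: esup_Some => [_ [a _ <-]|M hM].
  apply: enat_le_emin => z z' [Sz ez] [Sz' ez'].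
  have [||_ /=] := congruence_fact_rel _ (chain_congruence N) _ (z, z').
  - move=> [p q] pq; have [pqS _ _ pIq _] := sigma_isolated _ _ pq; split=> //=.
    have [/= Sp Sq epq] := pqS.
    exists [:: q]; split=> //= [w|]; first by rewrite inE => /eqP ->; split.
    by rewrite andbT fact_dist_disjoint// sigma_le.
  - by split; rewrite //= ez.
  - by rewrite ez.
apply: sigma_sup => p q pq.
have [[/= Sp Sq epq] p0 q0 pIq pE] := sigma_isolated _ _ pq.
have [|k kM] := enat_le_eminE _ _ (hM (catenary_degree_at S (fact_eval p)) _).
  by exists (fact_eval p) => //; exact: fact_eval_monoid.
case/(_ p q); [by split|by split|move=> s [sS sp sl]].
apply: leq_trans kM; rewrite -fact_dist_disjoint//.
elim: s sS sp sl => [_ _ /= pq'|w s IHs sS /= /andP[pw wp] sl].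
  by rewrite pq' fact_distxx.
have [wE|wE] := pE w (sS _ (mem_head _ _)); subst w; last exact: pw.
by apply: IHs => // w ws; apply: sS; rewrite in_cons ws orbT.
Qed.

(** One exchange inside [z] costs at most the longer side of the relation used. Conversely, for [u]
    in [q], the only factorization of the value of [p] containing [u] is [q], so the full distance
    from [p] to [q] is needed. *)
Lemma exchange_tame : tame_degree S = Some N.
Proof.
apply: esup_Some => [_ [a Sa [u Su <-]]|M hM].
  apply: enat_le_emin => -[w [Sw ew] uw] z [Sz ez].
  have [uz|uz] := boolP (u \in z); first by exists z; rewrite fact_distxx.
  have zw : fact_rel S (z, w) by split; rewrite //= ew.
  have [p [q [r [pq zE Sr uq]]]] := exchange_step _ _ _ zw uw uz.
  have [[/= Sp Sq epq] _ _ _ _] := sym_isolated _ _ pq.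
  exists (q `+` r)%mset; rewrite in_msetD uq; split=> //.
    by split; [exact: fact_monoidD|rewrite -ez zE !fact_evalD epq].
  rewrite zE fact_distD; exact: leq_trans (fact_dist_le _ _) (sym_le _ _ pq).
apply: sigma_sup => p q pq.
have [[/= Sp Sq epq] p0 q0 pIq pE] := sigma_isolated _ _ pq.
have [u uq] := mset_neq0_ex _ q0.
have [|k kM] := enat_le_eminE _ _ (hM (tame_degree_at S (fact_eval p) u) _).
  by exists (fact_eval p); [exact: fact_eval_monoid|exists u; [exact: Sq|]].
case/(_ _ p) => [||z' [/pE zE uz' dz]]; [by exists q|by split|].
apply: leq_trans kM; rewrite -fact_dist_disjoint//.
have [z'E|<-//] := zE; subst z'.
by have := in_mset0 u; rewrite -pIq in_msetI uz' uq.
Qed.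

(** Translates divisibility by an atom, as used by the omega invariant, into occurrence in a
    factorization. *)
Lemma divides_factorization u x : atoms S u -> fact_monoid S x ->
  divides S u (fact_eval x) ->
  exists2 w, factorizations S (fact_eval x) w & u \in w.
Proof.
move=> Su Sx [le Sd]; have [z [Sz ez]] := factorization_exists _ Sd.
exists (u +` z)%mset; last by rewrite in_mset1D eqxx.
by split; [exact/fact_monoidD/Sz/fact_monoid1|rewrite fact_evalD fact_eval1 ez
  subnKC].
Qed.

Lemma sub_divides u x y : fact_monoid S y -> (x `<=` y)%mset -> u \in x ->
  divides S u (fact_eval y).
Proof.
move=> Sy xy ux; have uy : u \in y by exact: msubset_subset xy _ ux.
have /= := fact_evalD [mset u]%mset (y `\ u)%mset; rewrite msetB1K// fact_eval1 => ->.
split; first exact: leq_addr.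
by rewrite addKn; apply/fact_eval_monoid/fact_monoidS/Sy/msubD1set.
Qed.

(** Factor all summands and let [Z] be the sum of the factorizations. If [u] is not in [Z], some
    side [p] inside [Z] can be traded for a side containing [u], and at most [size p] summands cover
    [p]. The lower bound takes the atoms of a side as the summands. *)
Lemma exchange_omega : omega S = Some N.
Proof.
apply: esup_Some => [_ [u Su <-]|M hM].
  apply: enat_le_emin => n a _ Sa ua.
  have [z hz] : exists z : 'I_n -> {mset nat}%mset, forall i, factorizations S (a i)
    (z i).
    have /choice[z hz] : forall i, exists zi, factorizations S (a i) zi.
      by move=> i; exact: factorization_exists.
    by exists z.
  pose Z (P : pred 'I_n) := (\big[msetD/mset0]_(i | P i) z i)%mset.
  have SZ P : fact_monoid S (Z P).
    rewrite /Z; elim/big_ind: _ => [||i _];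
      [exact: fact_monoid0|exact: fact_monoidD|].
    by case: (hz i).
  have eZ P : fact_eval (Z P) = \sum_(i | P i) a i.
    rewrite /Z (big_morph fact_eval fact_evalD fact_eval0).
    by apply: eq_bigr => i _; case: (hz i).
  have [uZ|uZ] := boolP (u \in Z predT).
    have [Om [Om1 uOm]] : exists Om : {set 'I_n}, #|Om| <= 1 /\ ([mset u] `<=` Z (mem
      Om))%mset.
      have := @msubset_sum_bound n z [mset u]%mset; rewrite enum_msetn /=; apply.
      apply/msubsetP => v; rewrite msetnE; case: eqP => [->|//]; by rewrite mset_gt0.
    (* One summand already contains [u], and [1 <= N]. *)
    exists Om; split; first exact: leq_trans N_gt0.
    rewrite -eZ; exact: sub_divides uOm (mset11 u).
  have [w [Sw ew] uw] : exists2 w, factorizations S (fact_eval (Z predT)) w & u \in w.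
    by apply: divides_factorization; rewrite // eZ.
  have Zw : fact_rel S (Z predT, w) by split; rewrite //= ew.
  have [p [q [pq pZ uq]]] := sigma_exchange _ _ _ Zw uw uZ.
  have [Om [Omp pOm]] := msubset_sum_bound _ _ _ pZ.
  exists Om; split.
    by apply: leq_trans Omp _; apply: leq_trans (sym_le _ _ pq); exact: leq_maxl.
  have [[/= Sp Sq epq] _ _ _ _] := sym_isolated _ _ pq.
  have SOm := SZ (mem Om).
  (* Trading [p] for [q] inside the selected part keeps its value and exhibits [u]. *)
  have -> : \sum_(i in Om) a i = fact_eval (q `+` (Z (mem Om) `\` p))%mset.
    by rewrite -(eZ (mem Om)) fact_evalD -epq -fact_evalD msetBDKC.
  apply: (sub_divides u q) => //.
    by apply: fact_monoidD => //; apply: fact_monoidS (msubsetDl _ _) _.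
  by apply/msubsetP => v; rewrite msetE2 leq_addr.
(* The atoms of [p], listed with multiplicity, sum to the value of [q], hence to a multiple of any
   atom [u] of [q]; no proper part of the list will do. *)
have half p q : isolated_pair p q -> size p <= M.
  move=> [[/= Sp Sq epq] p0 q0 pIq pE].
  have [u uq] := mset_neq0_ex _ q0.
  have [|k kM] := enat_le_eminE _ _ (hM (omega_at S u) _).
    by exists u => //; exact: Sq.
  have sumE (P : pred 'I_(size p)) :
      \sum_(i | P i) nth 0 p i = fact_eval (\big[msetD/mset0]_(i | P i) [mset (nth 0
        p i)])%mset.
    rewrite (big_morph fact_eval fact_evalD fact_eval0).
    by apply: eq_bigr => i _; rewrite fact_eval1.
  have pS i : i < size p -> atoms S (nth 0 p i) by move=> ip; apply/Sp/mem_nth.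
  have pE' : p = (\big[msetD/mset0]_(i < size p) [mset (nth 0 p i)])%mset.
    exact: mset_sum_nth.
  case/(_ (size p) (fun i => nth 0 p i)).
  - by rewrite lt0n; apply: contraNneq p0 => /mset_eq0_size ->.
  - by move=> i; have [] := pS i (ltn_ord i).
  - rewrite sumE -pE' epq; exact: sub_divides (msubset_refl _) uq.
  move=> Om [Omk uOm]; apply: leq_trans kM; apply: leq_trans Omk.
  rewrite sumE in uOm.
  set x := (X in fact_eval X) in uOm.
  pose y := (\big[msetD/mset0]_(i | i \notin Om) [mset (nth 0 p i)])%mset.
  have pxy : p = (x `+` y)%mset.
    by apply/msetP => a; rewrite [in LHS]pE' msetE2 !mset_sumE (bigID (mem Om)).
  have Sx : fact_monoid S x by apply: fact_monoidS Sp; rewrite pxy;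
    apply/msubsetP => a; rewrite msetE2 leq_addr.
  have Sy : fact_monoid S y by apply: fact_monoidS Sp; rewrite pxy;
    apply/msubsetP => a; rewrite msetE2 leq_addl.
  have [w [Sw ew] uw] := divides_factorization _ _ (Sq _ uq) Sx uOm.
  (* If [w] factors the chosen part and contains [u], then [w + y] is [p] or [q]. It is not [p],
     which avoids [u]; so it is [q], and [y] lies in both [p] and [q]. *)
  have y0 : y = mset0.
    have [|wyp|wyq] := pE (w `+` y)%mset.
    - by split; [exact: fact_monoidD|rewrite fact_evalD ew -fact_evalD -pxy].
    - by have := in_mset0 u; rewrite -pIq in_msetI uq -wyp in_msetD uw.
    - apply/eqP; rewrite -msubset0 -pIq; apply/msubsetP => a.
      by rewrite -wyq {1}pxy !msetE2 leq_min !leq_addl.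
  have xOm : size x <= #|Om|.
    rewrite /x (big_morph (fun x : {mset nat}%mset => size x) size_msetD (congr1 size
      enum_mset0)).
    by rewrite -sum1_card; apply: leq_sum => i _; rewrite enum_msetn.
  apply: leq_trans xOm; have := congr1 (fun m : {mset nat}%mset => size m) pxy.
  by rewrite y0 msetD0 => /eq_leq.
apply: sigma_sup => p q pq; rewrite geq_max; have pqi := sigma_isolated _ _ pq.
by rewrite (half _ _ pqi)// (half _ _ (isolated_pairC _ _ pqi)).
Qed.

End GenericRelations.
End Factorizations.

(** * Arithmetic of the three relations between three generators *)

Definition minimal_multiple n1 n2 n3 c :=
  forall m x y, 0 < m -> m * n1 = x * n2 + y * n3 -> c <= m.

(** Herzog's system of relations in the case where all six coefficients are positive. It is stable
    under permuting the indices, so statements proved for index 1 transfer to the others by the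
    swaps below. *)
Record herzog n1 n2 n3 c1 c2 c3 r12 r13 r21 r23 r31 r32 : Prop := Herzog {
  herzog_n1 : 0 < n1; herzog_n2 : 0 < n2; herzog_n3 : 0 < n3;
  herzog_c1 : minimal_multiple n1 n2 n3 c1;
  herzog_c2 : minimal_multiple n2 n1 n3 c2;
  herzog_c3 : minimal_multiple n3 n1 n2 c3;
  herzog_e1 : c1 * n1 = r12 * n2 + r13 * n3;
  herzog_e2 : c2 * n2 = r21 * n1 + r23 * n3;
  herzog_e3 : c3 * n3 = r31 * n1 + r32 * n2;
  herzog_r12 : 0 < r12; herzog_r13 : 0 < r13;
  herzog_r21 : 0 < r21; herzog_r23 : 0 < r23;
  herzog_r31 : 0 < r31; herzog_r32 : 0 < r32 }.

Lemma minimal_multipleC n1 n2 n3 c :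
  minimal_multiple n1 n2 n3 c -> minimal_multiple n1 n3 n2 c.
Proof. by move=> min1 m x y m0 e; apply: (min1 m y x m0); rewrite addnC. Qed.

Lemma herzog_swap12 n1 n2 n3 c1 c2 c3 r12 r13 r21 r23 r31 r32 :
  herzog n1 n2 n3 c1 c2 c3 r12 r13 r21 r23 r31 r32 ->
  herzog n2 n1 n3 c2 c1 c3 r21 r23 r12 r13 r32 r31.
Proof. by case=> *; split=> //; [exact: minimal_multipleC|rewrite addnC]. Qed.

Lemma herzog_swap23 n1 n2 n3 c1 c2 c3 r12 r13 r21 r23 r31 r32 :
  herzog n1 n2 n3 c1 c2 c3 r12 r13 r21 r23 r31 r32 ->
  herzog n1 n3 n2 c1 c3 c2 r13 r12 r31 r32 r21 r23.
Proof. by case=> *; split=> //; [exact: minimal_multipleC|rewrite addnC]. Qed.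

(** Cancelling common terms leaves [(x1 - y1) * n1] as a combination of [n2] and [n3]; it is zero,
    or minimality of [c] applies. *)
Lemma minimal_multiple_sub n1 n2 n3 c x1 x2 x3 y1 y2 y3 :
  0 < n1 -> 0 < n2 -> 0 < n3 -> minimal_multiple n1 n2 n3 c ->
  x1 * n1 + x2 * n2 + x3 * n3 = y1 * n1 + y2 * n2 + y3 * n3 ->
  x2 <= y2 -> x3 <= y3 ->
  (x1 = y1 /\ x2 = y2 /\ x3 = y3) \/ c + y1 <= x1.
Proof.
move=> n1_gt0 n2_gt0 n3_gt0 min1 e /subnKC xy2 /subnKC xy3.
move: (y2 - x2) (y3 - x3) xy2 xy3 => d2 d3 yE2 yE3.
move: e; rewrite -yE2 -yE3 !mulnDl => e.
have {}e : x1 * n1 = y1 * n1 + (d2 * n2 + d3 * n3) by lia.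
have xy1 : y1 <= x1 by rewrite -(leq_pmul2r n1_gt0) e leq_addr.
have [xy|xy] := ltnP y1 x1.
  right; rewrite addnC -leq_subRL//; apply: (min1 _ d2 d3); first by rewrite subn_gt0.
  by rewrite mulnBl e addKn.
have xy1E : x1 = y1 by apply/eqP; rewrite eqn_leq xy.
left; split=> //; nia.
Qed.

Section Herzog.
Variables n1 n2 n3 c1 c2 c3 r12 r13 r21 r23 r31 r32 : nat.
Hypothesis H : herzog n1 n2 n3 c1 c2 c3 r12 r13 r21 r23 r31 r32.

(** With [z2 < c2] and [z3 < c3], minimality forces [w2 <= z2] and [w3 <= z3], so a multiple of [n1]
    remains and [c1 <= w1]. Replacing [c1 * n1] in [w] by [r12 * n2 + r13 * n3] and comparing with
    [z] again gives the third alternative. *)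
Lemma herzog_exchange z2 z3 w1 w2 w3 : 0 < w1 ->
  z2 * n2 + z3 * n3 = w1 * n1 + w2 * n2 + w3 * n3 ->
  [\/ c2 <= z2, c3 <= z3 | r12 <= z2 /\ r13 <= z3].
Proof.
case: H => n1_gt0 n2_gt0 n3_gt0 m1 m2 m3 e1 e2 e3 ? ? ? ? ? ? w1_gt0 e.
have [?|z2c] := leqP c2 z2; first by constructor 1.
have [?|z3c] := leqP c3 z3; first by constructor 2.
constructor 3.
have z2w : w2 <= z2.
  rewrite leqNgt; apply/negP => /ltnW zw.
  by have [] := minimal_multiple_sub n3 n1 n2 c3 z3 0 z2 w3 w1 w2 n3_gt0 n1_gt0
    n2_gt0 m3; lia.
have z3w : w3 <= z3.
  rewrite leqNgt; apply/negP => /ltnW zw.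
  by have [] := minimal_multiple_sub n2 n1 n3 c2 z2 0 z3 w2 w1 w3 n2_gt0 n1_gt0
    n3_gt0 m2; lia.
have cw : c1 <= w1.
  by have [] := minimal_multiple_sub n1 n2 n3 c1 w1 w2 w3 0 z2 z3 n1_gt0 n2_gt0
    n3_gt0 m1; lia.
have {}e : z2 * n2 + z3 * n3 = (w1 - c1) * n1 + (w2 + r12) * n2 + (w3 + r13) * n3.
  have : c1 * n1 <= w1 * n1 by rewrite leq_mul2r cw orbT.
  by rewrite mulnBl !mulnDl; lia.
split; rewrite leqNgt; apply/negP => zr.
  by have [] := minimal_multiple_sub n3 n1 n2 c3 z3 0 z2 (w3 + r13) (w1 - c1) (w2 +
    r12) n3_gt0 n1_gt0 n2_gt0 m3; lia.
by have [] := minimal_multiple_sub n2 n1 n3 c2 z2 0 z3 (w2 + r12) (w1 - c1) (w3 +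
  r13) n2_gt0 n1_gt0 n3_gt0 m2; lia.
Qed.

Lemma herzog_isolated x1 x2 x3 :
  x1 * n1 + x2 * n2 + x3 * n3 = c1 * n1 ->
  (x1 = c1 /\ x2 = 0 /\ x3 = 0) \/ (x1 = 0 /\ x2 = r12 /\ x3 = r13).
Proof.
case: H => n1_gt0 n2_gt0 n3_gt0 m1 m2 m3 e1 e2 e3 r12_gt0 r13_gt0 ? ? ? ? e.
have [x1_gt0|] := ltnP 0 x1.
  left.
  by have [] := minimal_multiple_sub n1 n2 n3 c1 c1 0 0 x1 x2 x3 n1_gt0 n2_gt0 n3_gt0
    m1; lia.
rewrite leqn0 => /eqP x1E; right; subst x1.
have [x2r|x2r] := leqP x2 r12; have [x3r|x3r] := leqP x3 r13.
- by have [] := minimal_multiple_sub n1 n2 n3 c1 0 x2 x3 0 r12 r13 n1_gt0 n2_gt0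
    n3_gt0 m1; lia.
(* Here [c3 <= x3]; rewriting [c3 * n3] introduces [n1] with coefficient [r31 > 0], against the
   minimality of [c1]. The next case is the same with [n2] in place of [n3]. *)
- have [||| |cx] := minimal_multiple_sub n3 n1 n2 c3 x3 0 x2 r13 0 r12 n3_gt0 n1_gt0
    n2_gt0 m3; try lia.
  by have [] := minimal_multiple_sub n1 n2 n3 c1 c1 0 0 r31 (x2 + r32) (x3 - c3)
    n1_gt0 n2_gt0 n3_gt0 m1; lia.
- have [||| |cx] := minimal_multiple_sub n2 n1 n3 c2 x2 0 x3 r12 0 r13 n2_gt0 n1_gt0
    n3_gt0 m2; try lia.
  by have [] := minimal_multiple_sub n1 n2 n3 c1 c1 0 0 r21 (x2 - c2) (x3 + r23)
    n1_gt0 n2_gt0 n3_gt0 m1; lia.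
- by have [] := minimal_multiple_sub n1 n2 n3 c1 0 r12 r13 0 x2 x3 n1_gt0 n2_gt0
    n3_gt0 m1; lia.
Qed.

End Herzog.

(* For [0 < m < n3] with [m * n1] congruent to [n2] modulo [n3], either
   [m * n1] lies in <n2, n3>, so that [c <= m], or [n2] lies in <n1, n3>. *)
Lemma minimal_multiple_lt n1 n2 n3 c : 0 < n1 -> 1 < n3 ->
  coprime n1 n3 -> coprime n2 n3 ->
  (forall x y, n2 <> x * n1 + y * n3) -> minimal_multiple n1 n2 n3 c -> c < n3.
Proof.
move=> n1_gt0 n3_gt1 co13 co23 atom2 min1.
(* Bezout: [u] inverts [n1] modulo [n3], so the residue of [u * n2] is the required [m]. *)
have [u v uv _] := egcdnP n3 n1_gt0.
pose m := (u * n2) %% n3.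
have m_lt : m < n3 by rewrite ltn_mod ltnW.
have mE : m * n1 = n2 %[mod n3].
  rewrite modnMml -mulnA [n2 * _]mulnC mulnA uv (eqP co13) mulnDl mul1n -mulnA [n3 *
    _]mulnC mulnA.
  by rewrite modnMDl.
have m_gt0 : 0 < m.
  rewrite lt0n; apply/eqP => m0; move: mE; rewrite m0 mul0n mod0n => /esym/eqP;
    rewrite -/(n3 %| n2) => n3n2.
  have := dvdn_gcd n3 n2 n3; rewrite (eqP co23) dvdnn n3n2 dvdn1 => /eqP n3_1;
    by rewrite n3_1 in n3_gt1.
have [le|/ltnW le] := leqP n2 (m * n1).
  have : n3 %| m * n1 - n2 by rewrite -eqn_mod_dvd// mE.
  case/dvdnP => t tE; apply: leq_ltn_trans m_lt; apply: (min1 m 1 t m_gt0); lia.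
have : n3 %| n2 - m * n1 by rewrite -eqn_mod_dvd// mE.
by case/dvdnP => t tE; case: (atom2 m t); lia.
Qed.

(** If [r2 = 0], then [n3] divides [c * n1], hence [c] by coprimality, against [0 < c < n3]. *)
Lemma coefficient_gt0 n1 n2 n3 c r2 r3 : 0 < n1 -> 1 < n3 ->
  coprime n1 n3 -> coprime n2 n3 ->
  (forall x y, n2 <> x * n1 + y * n3) -> minimal_multiple n1 n2 n3 c ->
  0 < c -> c * n1 = r2 * n2 + r3 * n3 -> 0 < r2.
Proof.
move=> n1_gt0 n3_gt1 co13 co23 atom2 min1 c_gt0 e.
have := minimal_multiple_lt _ _ _ _ n1_gt0 n3_gt1 co13 co23 atom2 min1.
rewrite !lt0n; apply: contraTneq => r0; rewrite -leqNgt dvdn_leq//.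
by rewrite -(@Gauss_dvdl _ _ n1) 1?coprime_sym// e r0 mul0n add0n dvdn_mull.
Qed.

Lemma fact_eval_msetn c n : fact_eval (msetn c n) = c * n.
Proof. by rewrite /fact_eval enum_msetn big_nseq iter_addn_0 mulnC. Qed.

(** * Factorizations over three atoms in coordinates *)

Definition three_atoms (S : set nat) n1 n2 n3 :=
  [/\ n1 <> n2, n1 <> n3, n2 <> n3
    & forall u, atoms S u <-> [\/ u = n1, u = n2 | u = n3]].

Lemma three_atoms_swap12 S n1 n2 n3 :
  three_atoms S n1 n2 n3 -> three_atoms S n2 n1 n3.
Proof.
case=> n12 n13 n23 Satoms; split=> // [/esym//|u]; rewrite Satoms.
by split; case=> ->; [constructor 2|constructor 1|constructor 3|constructor
  2|constructor 1|constructor 3].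
Qed.

Lemma three_atoms_swap23 S n1 n2 n3 :
  three_atoms S n1 n2 n3 -> three_atoms S n1 n3 n2.
Proof.
case=> n12 n13 n23 Satoms; split=> // [/esym//|u]; rewrite Satoms.
by split; case=> ->; [constructor 1|constructor 3|constructor 2|constructor
  1|constructor 3|constructor 2].
Qed.

Section ThreeAtoms.
Variables (S : set nat) (n1 n2 n3 : nat).
Hypothesis hS : numerical_monoid S.
Hypothesis S3 : three_atoms S n1 n2 n3.

Lemma atom1 : atoms S n1. Proof. by case: S3 => _ _ _ ->; constructor 1. Qed.
Lemma atom2 : atoms S n2. Proof. by case: S3 => _ _ _ ->; constructor 2. Qed.
Lemma atom3 : atoms S n3. Proof. by case: S3 => _ _ _ ->; constructor 3. Qed.

Lemma atom_gt0 : 0 < n1.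
Proof. by case: atom1 => _ /eqP; rewrite lt0n. Qed.

Lemma monoid_mul k a : S a -> S (k * a).
Proof.
by case: hS => S0 SD _ Sa; elim: k => [//|k IHk]; rewrite mulSn; exact: SD.
Qed.

(** Splitting off one generator would write the atom [n1] as a sum of two elements, so the remainder
    would vanish and [n1] would equal another atom. *)
Lemma atom_indecomposable x y : n1 <> x * n2 + y * n3.
Proof.
case: hS S3 => S0 SD _ [n12 n13 n23 _] e.
have [_ n1_neq0 n1_irr] := atom1.
have [S2 n2_neq0 _] := atom2; have [S3' n3_neq0 _] := atom3.
case: x e => [|x] e.
  case: y e => [|y] e; first lia.
  by case: (n1_irr n3 (y * n3)) => //; [exact: monoid_mul|lia..].
case: (n1_irr n2 (x * n2 + y * n3)) => //; [|lia..].
by apply: (SD _ _ _ _); exact: monoid_mul.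
Qed.

Lemma fact_monoid3 z : fact_monoid S z ->
  z = (msetn (z n1) n1 `+` msetn (z n2) n2 `+` msetn (z n3) n3)%mset.
Proof.
case: S3 => /eqP n12 /eqP n13 /eqP n23 Satoms Sz; apply/msetP => a;
  rewrite !msetE2 !msetnE.
have [aE|an1] := eqVneq a n1; first by subst a;
  rewrite (negPf n12) (negPf n13) !addn0.
have [aE|an2] := eqVneq a n2; first by subst a; rewrite (negPf n23) !addn0.
have [->|an3] := eqVneq a n3; first by [].
apply/eqP; rewrite mset_eq0; apply/negP => /Sz /Satoms[] aE; subst a.
- by rewrite eqxx in an1.
- by rewrite eqxx in an2.
- by rewrite eqxx in an3.
Qed.

Lemma fact_eval3 z : fact_monoid S z ->
  fact_eval z = z n1 * n1 + z n2 * n2 + z n3 * n3.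
Proof. by move=> /fact_monoid3 {1}->; rewrite !fact_evalD !fact_eval_msetn. Qed.

Lemma fact_monoid_msetn c u : atoms S u -> fact_monoid S (msetn c u).
Proof. by move=> Su v /=; rewrite in_msetn => /andP[_ /eqP ->]. Qed.

Variables c1 c2 c3 r12 r13 r21 r23 r31 r32 : nat.
Hypothesis H : herzog n1 n2 n3 c1 c2 c3 r12 r13 r21 r23 r31 r32.

Lemma herzog_c1_gt0 : 0 < c1.
Proof. case: H => *; rewrite lt0n; apply/eqP => c0; nia. Qed.

Lemma herzog_isolated_pair :
  isolated_pair S (msetn c1 n1) (msetn r12 n2 `+` msetn r13 n3)%mset.
Proof.
have [/eqP n12 /eqP n13 /eqP n23 Satoms] := S3.
have c1_gt0 := herzog_c1_gt0.
have r12_gt0 : 0 < r12 by case: H.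
split.
- split=> /=; first exact: fact_monoid_msetn atom1.
    apply: fact_monoidD; apply: fact_monoid_msetn; [exact: atom2|exact: atom3].
  by rewrite fact_evalD !fact_eval_msetn; case: H.
- by apply/eqP => /msetP /(_ n1); rewrite msetnxx mset0E; lia.
- by apply/eqP => /msetP /(_ n2); rewrite msetE2 msetnxx mset0E; lia.
- apply/msetP => a; rewrite !msetE2 !msetnE mset0E.
  case: eqP => [->|_]; last by rewrite min0n.
  by rewrite (negPf n12) (negPf n13) minn0.
- move=> z [Sz]; rewrite fact_eval3// fact_eval_msetn => /(herzog_isolated _ _ _ _ _
    _ _ _ _ _ _ _ H).
  rewrite [X in X = _ \/ X = _](fact_monoid3 _ Sz).
  case=> -[-> [-> ->]]; rewrite !msetn0; first by left; rewrite !msetD0.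
  by right; rewrite mset0D.
Qed.

Lemma herzog_exchange1 z w : fact_rel S (z, w) -> n1 \in w -> n1 \notin z ->
  [\/ (msetn c2 n2 `<=` z)%mset, (msetn c3 n3 `<=` z)%mset
    | (msetn r12 n2 `+` msetn r13 n3 `<=` z)%mset].
Proof.
move=> [/= Sz Sw ezw]; rewrite in_mset => w1 /mset_eq0P z1.
have subE c u : c <= z u -> (msetn c u `<=` z)%mset.
  by move=> cz; apply/msubsetP => a; rewrite msetnE; case: eqP => [->|].
have : z n2 * n2 + z n3 * n3 = w n1 * n1 + w n2 * n2 + w n3 * n3.
  by rewrite -(fact_eval3 _ Sw) -ezw (fact_eval3 _ Sz) z1.
case/(herzog_exchange _ _ _ _ _ _ _ _ _ _ _ _ H _ _ _ _ _ w1) => [/subE|/subE|[z2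
  z3]].
- by constructor 1.
- by constructor 2.
- constructor 3; rewrite (fact_monoid3 _ Sz) z1 msetn0 mset0D.
  have [_ _ /eqP n23 _] := S3.
  by apply: msetDSS; apply/msubsetP => a; rewrite !msetnE; case: eqP.
Qed.

End ThreeAtoms.

(** * The three relations as a generic presentation *)

Section HerzogRelations.
Variables (S : set nat) (n1 n2 n3 : nat).
Hypothesis hS : numerical_monoid S.
Hypothesis S3 : three_atoms S n1 n2 n3.
Variables c1 c2 c3 r12 r13 r21 r23 r31 r32 : nat.
Hypothesis H : herzog n1 n2 n3 c1 c2 c3 r12 r13 r21 r23 r31 r32.

(** Each relation appears in one orientation only, with the multiple of a single atom on the left,
    as minimality requires. *)
Definition herzog_relations : set ({mset nat}%mset * {mset nat}%mset) :=
  [set (msetn c1 n1, (msetn r12 n2 `+` msetn r13 n3)%mset);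
       (msetn c2 n2, (msetn r21 n1 `+` msetn r23 n3)%mset);
       (msetn c3 n3, (msetn r31 n1 `+` msetn r32 n2)%mset)].

Let H2 := herzog_swap12 _ _ _ _ _ _ _ _ _ _ _ _ H.
Let H3 := herzog_swap12 _ _ _ _ _ _ _ _ _ _ _ _ (herzog_swap23 _ _ _ _ _ _ _ _ _ _ _
  _ H).
Let S3_2 := three_atoms_swap12 _ _ _ _ S3.
Let S3_3 := three_atoms_swap12 _ _ _ _ (three_atoms_swap23 _ _ _ _ S3).

Lemma herzog_relations_isolated p q :
  herzog_relations (p, q) -> isolated_pair S p q.
Proof.
case=> [[]|] [-> ->].
- exact: (herzog_isolated_pair _ _ _ _ S3 _ _ _ _ _ _ _ _ _ H).
- exact: (herzog_isolated_pair _ _ _ _ S3_2 _ _ _ _ _ _ _ _ _ H2).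
- exact: (herzog_isolated_pair _ _ _ _ S3_3 _ _ _ _ _ _ _ _ _ H3).
Qed.

(** A left side involves one atom, a right side two, so no pair is the reverse of another. *)
Lemma herzog_relations_asym p q :
  herzog_relations (p, q) -> ~ herzog_relations (q, p).
Proof.
have [n12 n13 n23 _] := S3.
have single x y : herzog_relations (x, y) -> exists u, forall v, v \in x -> v = u.
  by case=> [[]|] [-> _]; [exists n1|exists n2|exists n3] => v;
    rewrite in_msetn => /andP[_ /eqP].
have double x y : herzog_relations (x, y) -> exists u v, [/\ u \in y, v \in y & u <>
  v].
  have [_ _ _ _ _ _ _ _ _ r12_gt0 r13_gt0 r21_gt0 r23_gt0 r31_gt0 r32_gt0] := H.
  by case=> [[]|] [_ ->]; [exists n2, n3|exists n1, n3|exists n1, n2];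
    rewrite !in_msetD !in_msetn !eqxx; split=> //; lia.
by move=> /double[u [v [uq vq uv]]] /single[a qa]; apply: uv; rewrite (qa u)// (qa v).
Qed.

(** By positivity of the coefficients, the multiple of any atom other than [u] trades for a side
    containing [u]; in the remaining case the relation of [u] itself is used from right to left. *)
Lemma herzog_relations_exchange : exchange S herzog_relations.
Proof.
have in1 : herzog_relations (msetn c1 n1, msetn r12 n2 `+` msetn r13 n3)%mset by left;
  left.
have in2 : herzog_relations (msetn c2 n2, msetn r21 n1 `+` msetn r23 n3)%mset by left;
  right.
have in3 : herzog_relations (msetn c3 n3, msetn r31 n1 `+` msetn r32 n2)%mset by
  right.
have c1_gt0 := herzog_c1_gt0 _ _ _ _ _ _ _ _ _ _ _ _ H.
have c2_gt0 := herzog_c1_gt0 _ _ _ _ _ _ _ _ _ _ _ _ H2.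
have c3_gt0 := herzog_c1_gt0 _ _ _ _ _ _ _ _ _ _ _ _ H3.
have [_ _ _ _ _ _ _ _ _ r12_gt0 r13_gt0 r21_gt0 r23_gt0 r31_gt0 r32_gt0] := H.
have [_ _ _ Satoms] := S3.
move=> u z w zw uw uz; have [_ /= Sw _] := zw.
have /Satoms uE : atoms S u by exact: Sw.
case: uE => uE; subst u.
- have [pz|pz|pz] := herzog_exchange1 _ _ _ _ S3 _ _ _ _ _ _ _ _ _ H _ _ zw uw uz.
  + exists (msetn c2 n2), (msetn r21 n1 `+` msetn r23 n3)%mset; split=> //;
      [by left|by rewrite in_msetD !in_msetn eqxx r21_gt0 ?orbT].
  + exists (msetn c3 n3), (msetn r31 n1 `+` msetn r32 n2)%mset; split=> //;
      [by left|by rewrite in_msetD !in_msetn eqxx r31_gt0 ?orbT].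
  + exists (msetn r12 n2 `+` msetn r13 n3)%mset, (msetn c1 n1); split=> //;
      [by right|by rewrite in_msetn eqxx c1_gt0].
- have [pz|pz|pz] := herzog_exchange1 _ _ _ _ S3_2 _ _ _ _ _ _ _ _ _ H2 _ _ zw uw uz.
  + exists (msetn c1 n1), (msetn r12 n2 `+` msetn r13 n3)%mset; split=> //;
      [by left|by rewrite in_msetD !in_msetn eqxx r12_gt0 ?orbT].
  + exists (msetn c3 n3), (msetn r31 n1 `+` msetn r32 n2)%mset; split=> //;
      [by left|by rewrite in_msetD !in_msetn eqxx r32_gt0 ?orbT].
  + exists (msetn r21 n1 `+` msetn r23 n3)%mset, (msetn c2 n2); split=> //;
      [by right|by rewrite in_msetn eqxx c2_gt0].
- have [pz|pz|pz] := herzog_exchange1 _ _ _ _ S3_3 _ _ _ _ _ _ _ _ _ H3 _ _ zw uw uz.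
  + exists (msetn c1 n1), (msetn r12 n2 `+` msetn r13 n3)%mset; split=> //;
      [by left|by rewrite in_msetD !in_msetn eqxx r13_gt0 ?orbT].
  + exists (msetn c2 n2), (msetn r21 n1 `+` msetn r23 n3)%mset; split=> //;
      [by left|by rewrite in_msetD !in_msetn eqxx r23_gt0 ?orbT].
  + exists (msetn r31 n1 `+` msetn r32 n2)%mset, (msetn c3 n3); split=> //;
      [by right|by rewrite in_msetn eqxx c3_gt0].
Qed.

Lemma herzog_relations_size M :
  \max_(x <- [:: c1; c2; c3; r12 + r13; r21 + r23; r31 + r32]) x <= M <->
  forall p q, herzog_relations (p, q) -> maxn (size p) (size q) <= M.
Proof.
rewrite !big_cons big_nil; split=> [leM x y|leM].
  by case=> [[]|] [-> ->]; rewrite size_msetD !enum_msetn !size_nseq; lia.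
have := leM _ _ (or_introl (or_introl erefl)).
have := leM _ _ (or_introl (or_intror erefl)).
have := leM _ _ (or_intror erefl).
by rewrite !size_msetD !enum_msetn !size_nseq; lia.
Qed.

Lemma herzog_relations_support p q :
  herzog_relations (p, q) -> [set` p] `|` [set` q] = atoms S.
Proof.
have c1_gt0 := herzog_c1_gt0 _ _ _ _ _ _ _ _ _ _ _ _ H.
have c2_gt0 := herzog_c1_gt0 _ _ _ _ _ _ _ _ _ _ _ _ H2.
have c3_gt0 := herzog_c1_gt0 _ _ _ _ _ _ _ _ _ _ _ _ H3.
have [_ _ _ _ _ _ _ _ _ r12_gt0 r13_gt0 r21_gt0 r23_gt0 r31_gt0 r32_gt0] := H.
have [_ _ _ Satoms] := S3 => pq.
have pqE u : (u \in p) || (u \in q) = [|| u == n1, u == n2 | u == n3].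
  by case: pq => [[]|] [-> ->]; rewrite in_msetD !in_msetn; lia.
apply/seteqP; split=> u /=.
  move=> /orP; rewrite pqE Satoms => /or3P[]/eqP ->;
    by [constructor 1|constructor 2|constructor 3].
move=> uS; apply/orP; rewrite pqE; apply/or3P.
by case/Satoms: uS => ->; [constructor 1|constructor 2|constructor 3].
Qed.

Let N := \max_(x <- [:: c1; c2; c3; r12 + r13; r21 + r23; r31 + r32]) x.

Lemma herzog_relations_generic : generic_presentation S herzog_relations.
Proof.
split; last exact: herzog_relations_support.
apply: (exchange_minimal _ hS).
- exact: herzog_relations_isolated.
- exact: herzog_relations_asym.
- exact: herzog_relations_exchange.
Qed.

Lemma herzog_degrees : [/\ catenary_degree S = Some N, omega S = Some N
  & tame_degree S = Some N].
Proof.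
have isol := herzog_relations_isolated.
have exch := herzog_relations_exchange.
have leN := (herzog_relations_size N).1 (leqnn _).
have supN M := (herzog_relations_size M).2.
have nonempty : herzog_relations !=set0 by eexists; right.
split.
- exact: (exchange_catenary _ hS _ isol exch _ leN supN).
- exact: (exchange_omega _ hS _ isol exch _ nonempty leN supN).
- exact: (exchange_tame _ hS _ isol exch _ leN supN).
Qed.

End HerzogRelations.

(** * From pairwise coprime atoms to the system of relations *)

Lemma emin_minimal_multiple n1 n2 n3 c :
  emin [set m | 0 < m /\ gen2 n2 n3 (m * n1)] = Some c ->
  0 < c /\ minimal_multiple n1 n2 n3 c.
Proof.
move=> /emin_SomeE[[c_gt0 _] cmin]; split=> // m x y m_gt0 e.
by apply: cmin; split=> //; exists x, y.
Qed.

Lemma emin_gen2_exists n1 n2 n3 : 0 < n2 ->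
  exists c x y, emin [set m | 0 < m /\ gen2 n2 n3 (m * n1)] = Some c /\
    c * n1 = x * n2 + y * n3.
Proof.
move=> n2_gt0.
have [|c cE] := emin_inhabited [set m | 0 < m /\ gen2 n2 n3 (m * n1)] n2.
  (* The set is nonempty since [n2 * n1 = n1 * n2 + 0 * n3]. *)
  by split=> //; exists n1, 0; rewrite mulnC addn0.
by have [[_ [x [y e]]] _] := emin_SomeE _ _ cE; exists c, x, y.
Qed.

Lemma herzog_coprime S n1 n2 n3 c1 c2 c3 r12 r13 r21 r23 r31 r32 :
  numerical_monoid S -> three_atoms S n1 n2 n3 ->
  coprime n1 n2 -> coprime n1 n3 -> coprime n2 n3 ->
  emin [set m | 0 < m /\ gen2 n2 n3 (m * n1)] = Some c1 ->
  emin [set m | 0 < m /\ gen2 n1 n3 (m * n2)] = Some c2 ->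
  emin [set m | 0 < m /\ gen2 n1 n2 (m * n3)] = Some c3 ->
  c1 * n1 = r12 * n2 + r13 * n3 ->
  c2 * n2 = r21 * n1 + r23 * n3 ->
  c3 * n3 = r31 * n1 + r32 * n2 ->
  herzog n1 n2 n3 c1 c2 c3 r12 r13 r21 r23 r31 r32.
Proof.
move=> hS S3 co12 co13 co23 /emin_minimal_multiple[c1_gt0 min1].
move=> /emin_minimal_multiple[c2_gt0 min2] /emin_minimal_multiple[c3_gt0 min3] e1 e2
  e3.
have S3_2 := three_atoms_swap12 _ _ _ _ S3.
have S3_3 := three_atoms_swap12 _ _ _ _ (three_atoms_swap23 _ _ _ _ S3).
have n1_gt0 := atom_gt0 _ _ _ _ S3.
have n2_gt0 := atom_gt0 _ _ _ _ S3_2.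
have n3_gt0 := atom_gt0 _ _ _ _ S3_3.
have ind1 := atom_indecomposable _ _ _ _ hS S3.
have ind2 := atom_indecomposable _ _ _ _ hS S3_2.
have ind3 := atom_indecomposable _ _ _ _ hS S3_3.
(* No atom is 1, since 1 would generate the other atoms. *)
have n1_gt1 : 1 < n1 by rewrite ltn_neqAle n1_gt0 andbT; apply/eqP => n1E;
  apply: (ind2 n2 0); lia.
have n2_gt1 : 1 < n2 by rewrite ltn_neqAle n2_gt0 andbT; apply/eqP => n2E;
  apply: (ind1 n1 0); lia.
have n3_gt1 : 1 < n3 by rewrite ltn_neqAle n3_gt0 andbT; apply/eqP => n3E;
  apply: (ind1 0 n1); lia.
have co21 : coprime n2 n1 by rewrite coprime_sym.
have co31 : coprime n3 n1 by rewrite coprime_sym.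
have co32 : coprime n3 n2 by rewrite coprime_sym.
have ind1' x y : n1 <> x * n3 + y * n2 by rewrite addnC.
have ind2' x y : n2 <> x * n3 + y * n1 by rewrite addnC.
have ind3' x y : n3 <> x * n2 + y * n1 by rewrite addnC.
split=> //.
- exact: (coefficient_gt0 _ _ _ _ _ _ n1_gt0 n3_gt1 co13 co23 ind2 min1 c1_gt0 e1).
- rewrite addnC in e1.
  exact: (coefficient_gt0 _ _ _ _ _ _ n1_gt0 n2_gt1 co12 co32 ind3 (minimal_multipleC
    _ _ _ _ min1) c1_gt0 e1).
- exact: (coefficient_gt0 _ _ _ _ _ _ n2_gt0 n3_gt1 co23 co13 ind1 min2 c2_gt0 e2).
- rewrite addnC in e2.
  exact: (coefficient_gt0 _ _ _ _ _ _ n2_gt0 n1_gt1 co21 co31 ind3'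
    (minimal_multipleC _ _ _ _ min2) c2_gt0 e2).
- exact: (coefficient_gt0 _ _ _ _ _ _ n3_gt0 n2_gt1 co32 co12 ind1' min3 c3_gt0 e3).
- rewrite addnC in e3.
  exact: (coefficient_gt0 _ _ _ _ _ _ n3_gt0 n1_gt1 co31 co21 ind2'
    (minimal_multipleC _ _ _ _ min3) c3_gt0 e3).
Qed.

Theorem corollary5p8 (S : set nat) (n1 n2 n3 : nat)
    (hS : numerical_monoid S)
    (hdistinct : [/\ n1 <> n2, n1 <> n3 & n2 <> n3])
    (hatoms : atoms S = [set n1; n2; n3])
    (h12 : gcdn n1 n2 = 1) (h13 : gcdn n1 n3 = 1) (h23 : gcdn n2 n3 = 1) :
  [/\ exists sigma, generic_presentation S sigma,
      catenary_degree S = omega S,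
      omega S = tame_degree S
    & forall c1 c2 c3 r12 r13 r21 r23 r31 r32 : nat,
        emin [set m | 0 < m /\ gen2 n2 n3 (m * n1)] = Some c1 ->
        emin [set m | 0 < m /\ gen2 n1 n3 (m * n2)] = Some c2 ->
        emin [set m | 0 < m /\ gen2 n1 n2 (m * n3)] = Some c3 ->
        c1 * n1 = r12 * n2 + r13 * n3 ->
        c2 * n2 = r21 * n1 + r23 * n3 ->
        c3 * n3 = r31 * n1 + r32 * n2 ->
        catenary_degree S =
          Some (\max_(x <- [:: c1; c2; c3; r12 + r13; r21 + r23; r31 + r32]) x)].
Proof.
have S3 : three_atoms S n1 n2 n3.
  case: hdistinct => n12 n13 n23; split=> // u; rewrite hatoms /=.
  by split=> [[[]|]|[]] ->; [constructor 1|constructor 2|constructor 3|left;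
    left|left; right|right].
have n1_gt0 := atom_gt0 _ _ _ _ S3.
have n2_gt0 := atom_gt0 _ _ _ _ (three_atoms_swap12 _ _ _ _ S3).
have [c1 [r12 [r13 [m1 e1]]]] := emin_gen2_exists n1 n2 n3 n2_gt0.
have [c2 [r21 [r23 [m2 e2]]]] := emin_gen2_exists n2 n1 n3 n1_gt0.
have [c3 [r31 [r32 [m3 e3]]]] := emin_gen2_exists n3 n1 n2 n1_gt0.
have herz := herzog_coprime _ _ _ _ _ _ _ _ _ _ _ _ _ hS S3 (introT eqP h12) (introT
  eqP h13) (introT eqP h23).
have H := herz _ _ _ _ _ _ _ _ _ m1 m2 m3 e1 e2 e3.
have [cE oE tE] := herzog_degrees _ _ _ _ hS S3 _ _ _ _ _ _ _ _ _ H.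
split.
- exists (herzog_relations n1 n2 n3 c1 c2 c3 r12 r13 r21 r23 r31 r32).
  exact: (herzog_relations_generic _ _ _ _ hS S3 _ _ _ _ _ _ _ _ _ H).
- by rewrite cE oE.
- by rewrite oE tE.
(* The formula concerns arbitrary admissible coefficients, not only those chosen above, so the
   degrees are computed again from the given relations. *)
- move=> d1 d2 d3 s12 s13 s21 s23 s31 s32 k1 k2 k3 f1 f2 f3.
  have H' := herz _ _ _ _ _ _ _ _ _ k1 k2 k3 f1 f2 f3.
  by have [] := herzog_degrees _ _ _ _ hS S3 _ _ _ _ _ _ _ _ _ H'.
Qed.
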